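(* Let $F$ be a field of characteristic $2$, let $\phi,\psi$ be (arbitrary, possibly singular) quadratic forms over $F$ with $\dim\phi=\dim\psi$, and let $L/F$ be a field extension of odd degree. Then $\phi$ and $\psi$ are similar over $F$ if and only if $\phi_L$ and $\psi_L$ are similar over $L$. More precisely, suppose $\lambda\in L^*$ satisfies $\phi_L\cong\lambda\psi_L$, and let $a_n$ be the constant term of the minimal polynomial $X^n+a_1X^{n-1}+\dots+a_n$ of $\lambda$ over $F$, where $n=[F(\lambda):F]$. Then $\phi\cong a_n\psi$ over $F$.
   Context: Two quadratic forms $\phi,\psi$ over a field $E$ are similar if $\phi\cong c\psi$ for some $c\in E^*$. *)

(* Defs.v *)
From HB Require Import structures.
From mathcomp Require Import all_boot all_order all_algebra all_field.
Set Implicit Arguments. Unset Strict Implicit. Unset Printing Implicit Defensive.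
Import GRing.Theory.
Local Open Scope ring_scope.

(* A quadratic form of dimension n over a field K is represented by a matrix
   A : 'M[K]_n, via  q_A(x) = x A x^T  (x a row vector).  In any characteristic
   (in particular char 2) every quadratic form on K^n arises this way
   (take A upper triangular); A need not be symmetric and q_A may be singular. *)
Definition qf (K : fieldType) (n : nat) (A : 'M[K]_n) (x : 'rV[K]_n) : K :=
  (x *m A *m x^T) 0 0.

Definition qf_isometric (K : fieldType) (n : nat) (A B : 'M[K]_n) : Prop :=
  exists2 P : 'M[K]_n, P \in unitmx & forall x, qf A (x *m P) = qf B x.

Definition qf_similar (K : fieldType) (n : nat) (A B : 'M[K]_n) : Prop :=
  exists2 c : K, c != 0 & qf_isometric A (c *: B).

Definition qf_ext (F : fieldType) (L : fieldExtType F) (n : nat) (A : 'M[F]_n)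
  : 'M[L]_n := map_mx (in_alg L) A.

(* Main.v *)
Require Import Defs.
From HB Require Import structures.
From mathcomp Require Import all_boot all_order all_algebra all_field.
From mathcomp Require Import ring zify.
From Stdlib Require Import Classical_Prop.
Import GRing.Theory.
Local Open Scope ring_scope.

Set Implicit Arguments. Unset Strict Implicit. Unset Printing Implicit Defensive.

(** Suppose [phi] and [psi] are anisotropic over [F], that [E = F(x)] has odd
degree [m = 2d+1] with minimal polynomial [p], and that [sigma] is an isometry
of [x psi] onto [phi] over [E].  The pairs [(v, w)] of vectors of polynomials of
degree at most [d] with [v(x) = sigma(w(x))] form an [F]-space of dimension at
least [n].  For such a pair [phi(v) - X psi(w)] has degree at most [m] and is
divisible by [p], hence equals [c p]; comparing the extreme coefficients gives
[phi(v_0) = - p(0) psi(w_d)], and by anisotropy and parity of degrees the pair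
is determined by [w_d].  So [w_d |-> v_0] is an isometry of [- p(0) psi] onto
[phi].

For [L/F(lam)], which is separable, the same result applies to a generator of
the form [t^2], whose minimal polynomial has a square constant term: the
isometry over [L] descends to [F(lam)], and then to [F] with [x = lam].

The general case follows by splitting off over [F] isotropic vectors of the
radical and hyperbolic planes, which can be cancelled over [L]; Springer's
theorem shows that both forms split off the same summands. *)

Lemma mx11_tr (R : nmodType) (M : 'M[R]_1) : M^T 0 0 = M 0 0.
Proof. by rewrite mxE. Qed.

Lemma addmx00 (R : nmodType) (M N : 'M[R]_1) : (M + N) 0 0 = M 0 0 + N 0 0.
Proof. by rewrite mxE. Qed.

Lemma submx00 (R : zmodType) (M N : 'M[R]_1) : (M - N) 0 0 = M 0 0 - N 0 0.
Proof. by rewrite !mxE. Qed.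

(** * Forms and polar forms *)

(** The polar form: many matrices give the same quadratic form, but by [bf_qf] they share this
    pairing. *)
Definition bf (K : fieldType) n (A : 'M[K]_n) (x y : 'rV[K]_n) : K :=
  (x *m (A + A^T) *m y^T) 0 0.

Definition osum (K : fieldType) m n (A : 'M[K]_m) (B : 'M[K]_n) : 'M[K]_(m + n) :=
  block_mx A 0 0 B.

Definition isotropic (K : fieldType) n (A : 'M[K]_n) : Prop :=
  exists2 v, v != 0 & qf A v = 0.

(** An isotropic vector in the radical of the polar form; it spans a zero summand that splits
    off. *)
Definition defective (K : fieldType) n (A : 'M[K]_n) : Prop :=
  exists v, [/\ v != 0, qf A v = 0 & forall y, bf A v y = 0].

Section Forms.
Variable K : fieldType.
Implicit Types n : nat.

Lemma bfC n (A : 'M[K]_n) x y : bf A x y = bf A y x.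
Proof.
by rewrite /bf -[LHS]mx11_tr !trmx_mul trmxK linearD /= trmxK mulmxA [A^T + A]addrC.
Qed.

Lemma bfDl n (A : 'M[K]_n) x y z : bf A (x + y) z = bf A x z + bf A y z.
Proof. by rewrite /bf !mulmxDl mxE. Qed.

Lemma bfZl n (A : 'M[K]_n) c x z : bf A (c *: x) z = c * bf A x z.
Proof. by rewrite /bf -!scalemxAl mxE. Qed.

Lemma bfDr n (A : 'M[K]_n) x y z : bf A z (x + y) = bf A z x + bf A z y.
Proof. by rewrite ![bf A z _]bfC bfDl. Qed.

Lemma bfZr n (A : 'M[K]_n) c x z : bf A z (c *: x) = c * bf A z x.
Proof. by rewrite ![bf A z _]bfC bfZl. Qed.

Lemma qfD n (A : 'M[K]_n) x y : qf A (x + y) = qf A x + qf A y + bf A x y.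
Proof.
rewrite /qf /bf linearD /= !mulmxDr !mulmxDl !addmx00.
have -> : (x *m A^T *m y^T) 0 0 = (y *m A *m x^T) 0 0.
  by rewrite -mx11_tr !trmx_mul !trmxK mulmxA.
ring.
Qed.

Lemma qfZ n (A : 'M[K]_n) c x : qf A (c *: x) = c ^+ 2 * qf A x.
Proof. by rewrite /qf linearZ /= -!scalemxAl -scalemxAr [LHS]mxE [X in c * X]mxE mulrA. Qed.

Lemma qf0 n (A : 'M[K]_n) : qf A 0 = 0.
Proof. by rewrite /qf !mul0mx mxE. Qed.

Lemma qf_scale n (A : 'M[K]_n) c x : qf (c *: A) x = c * qf A x.
Proof. by rewrite /qf -scalemxAr -scalemxAl mxE. Qed.

Lemma bf_qf n (A : 'M[K]_n) x y : bf A x y = qf A (x + y) - qf A x - qf A y.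
Proof. by rewrite qfD; ring. Qed.

Lemma bfxx n (A : 'M[K]_n) x : bf A x x = 2%:R * qf A x.
Proof. by rewrite bf_qf -mulr2n -scaler_nat qfZ; ring. Qed.

Lemma qf_mul n m (A : 'M[K]_n) (P : 'M[K]_(m, n)) x :
  qf A (x *m P) = qf (P *m A *m P^T) x.
Proof. by rewrite /qf trmx_mul !mulmxA. Qed.

Lemma bf_iso n m (A : 'M[K]_n) (B : 'M[K]_m) (P : 'M[K]_(m, n)) :
  (forall x, qf A (x *m P) = qf B x) ->
  forall x y, bf A (x *m P) (y *m P) = bf B x y.
Proof. by move=> h x y; rewrite !bf_qf -mulmxDl !h. Qed.

Lemma qf_isometric_refl n (A B : 'M[K]_n) :
  (forall x, qf A x = qf B x) -> qf_isometric A B.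
Proof. by move=> h; exists 1%:M; rewrite ?unitmx1 // => x; rewrite mulmx1. Qed.

Lemma qf_isometric_sym n (A B : 'M[K]_n) : qf_isometric A B -> qf_isometric B A.
Proof.
case=> P uP h; exists (invmx P); first by rewrite unitmx_inv.
by move=> x; rewrite -h mulmxKV.
Qed.

Lemma qf_isometric_trans n (B A C : 'M[K]_n) :
  qf_isometric A B -> qf_isometric B C -> qf_isometric A C.
Proof.
case=> P uP h [Q uQ k]; exists (Q *m P); first by rewrite unitmx_mul uP uQ.
by move=> x; rewrite mulmxA h k.
Qed.

Lemma qf_isometric_scale n (A B : 'M[K]_n) c :
  qf_isometric A B -> qf_isometric (c *: A) (c *: B).
Proof. by case=> P uP h; exists P => // x; rewrite !qf_scale h. Qed.

Lemma qf_isometric_square n (A : 'M[K]_n) c :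
  c != 0 -> qf_isometric A (c ^+ 2 *: A).
Proof.
move=> c0; exists (c%:M); first by rewrite unitmxE det_scalar unitrX // unitfE.
by move=> x; rewrite mul_mx_scalar qfZ qf_scale.
Qed.

Lemma qf_osum m n (A : 'M[K]_m) (B : 'M[K]_n) x y :
  qf (osum A B) (row_mx x y) = qf A x + qf B y.
Proof.
by rewrite /qf /osum mul_row_block !mulmx0 addr0 add0r tr_row_mx mul_row_col mxE.
Qed.

Lemma qf_isometric_osum m n (A A' : 'M[K]_m) (B B' : 'M[K]_n) :
  qf_isometric A A' -> qf_isometric B B' ->
  qf_isometric (osum A B) (osum A' B').
Proof.
case=> P uP h [Q uQ k]; exists (block_mx P 0 0 Q).
  by rewrite unitmxE det_lblock unitrM -!unitmxE uP uQ.
move=> x; rewrite -(hsubmxK x) mul_row_block !mulmx0 addr0 add0r.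
by rewrite !qf_osum h k.
Qed.

Lemma scale_osum m n (A : 'M[K]_m) (B : 'M[K]_n) c :
  c *: osum A B = osum (c *: A) (c *: B).
Proof. by rewrite /osum scale_block_mx !scaler0. Qed.

Lemma row_free_injective m n (P : 'M[K]_(m, n)) :
  (forall x : 'rV_m, x *m P = 0 -> x = 0) -> row_free P.
Proof.
move=> h; rewrite -kermx_eq0; apply/eqP/row_matrixP => i.
by rewrite row0; apply: h; apply/sub_kermxP; rewrite row_sub.
Qed.

Lemma unitmx_injective n (P : 'M[K]_n) :
  (forall x : 'rV_n, x *m P = 0 -> x = 0) -> P \in unitmx.
Proof. by rewrite -row_free_unit; apply: row_free_injective. Qed.

Lemma isotropic_isometric n (A B : 'M[K]_n) :
  qf_isometric A B -> isotropic A -> isotropic B.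
Proof.
move=> /qf_isometric_sym [P uP h] [v v0 Av]; exists (v *m P); last by rewrite h.
by apply: contraNneq v0 => e; rewrite -(mulmxK uP v) e mul0mx.
Qed.

Lemma defective_isometric n (A B : 'M[K]_n) :
  qf_isometric A B -> defective A -> defective B.
Proof.
move=> /qf_isometric_sym [P uP h] [v [v0 Av bv]]; exists (v *m P); split.
- by apply: contraNneq v0 => e; rewrite -(mulmxK uP v) e mul0mx.
- by rewrite h.
- by move=> y; rewrite -(mulmxKV uP y) (bf_iso h).
Qed.

Lemma isotropic_scale n (A : 'M[K]_n) c :
  c != 0 -> isotropic (c *: A) <-> isotropic A.
Proof.
move=> c0; split=> -[v v0 Av]; exists v => //; last by rewrite qf_scale Av mulr0.
by move/eqP: Av; rewrite qf_scale mulf_eq0 (negPf c0) => /eqP.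
Qed.

Lemma defective_scale n (A : 'M[K]_n) c :
  c != 0 -> defective (c *: A) <-> defective A.
Proof.
move=> c0; have bfS x y : bf (c *: A) x y = c * bf A x y.
  by rewrite !bf_qf !qf_scale; ring.
split=> -[v [v0 Av bv]]; exists v; split=> //.
- by move/eqP: Av; rewrite qf_scale mulf_eq0 (negPf c0) => /eqP.
- by move=> y; move/eqP: (bv y); rewrite bfS mulf_eq0 (negPf c0) => /eqP.
- by rewrite qf_scale Av mulr0.
- by move=> y; rewrite bfS bv mulr0.
Qed.

(** As [G] has full rank, the middle factor of its Gaussian decomposition is [pid_mx m], so the
    first [m] rows of [row_ebase G], multiplied by [col_ebase G], give back [G]. *)
Lemma row_free_complete m n (G : 'M[K]_(m, m + n)) :
  row_free G -> exists2 U : 'M_(m + n), U \in unitmx & usubmx U = G.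
Proof.
move=> fG; exists (block_mx (col_ebase G) 0 0 1%:M *m row_ebase G).
  by rewrite unitmx_mul row_ebase_unit unitmxE det_lblock det1 mulr1 -unitmxE col_ebase_unit.
rewrite -mul_usub_mx /block_mx col_mxKu -{3}(mulmx_ebase G) (eqP fG).
congr (_ *m _); rewrite -[col_ebase G in LHS]mulmx1 -[in LHS](mulmx0 _ (col_ebase G)).
by rewrite -mul_mx_row pid_mx_row.
Qed.

End Forms.

(** * Splitting and cancellation *)

Definition hyp (K : fieldType) : 'M[K]_(1 + 1) := block_mx 0 1%:M 0 0.

Section Witt.
Variable K : fieldType.
Implicit Types n : nat.

Lemma mulmx_rV1 n (a : 'rV[K]_1) (v : 'rV[K]_n) : a *m v = a 0 0 *: v.
Proof. by rewrite [a in LHS]mx11_scalar mul_scalar_mx. Qed.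

Lemma rV1_eq0 (a : 'rV[K]_1) : a 0 0 = 0 -> a = 0.
Proof. by move=> e; rewrite [a]mx11_scalar e raddf0. Qed.

Lemma rsubmx_mul m n p q (a : 'rV[K]_m) (y : 'rV[K]_n) (P : 'M[K]_(m + n, p + q)) :
  rsubmx (row_mx a y *m P) = a *m ursubmx P + y *m drsubmx P.
Proof. by rewrite -{1}(submxK P) mul_row_block row_mxKr. Qed.

Lemma qf_zero n (x : 'rV[K]_n) : qf 0 x = 0.
Proof. by rewrite /qf mulmx0 mul0mx mxE. Qed.

Lemma qf_hyp (a b : 'rV[K]_1) : qf (hyp K) (row_mx a b) = a 0 0 * b 0 0.
Proof.
rewrite /qf /hyp mul_row_block !mulmx0 mulmx1 !addr0 tr_row_mx mul_row_col.
by rewrite mul0mx add0r mulmx_rV1 mxE [b^T 0 0]mxE.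
Qed.

(** [hyp] is the form [ab], so dividing the first coordinate by [c] absorbs the factor. *)
Lemma hyp_scale c : c != 0 -> qf_isometric (c *: hyp K) (hyp K).
Proof.
move=> c0; exists (block_mx (c^-1)%:M 0 0 1%:M).
  by rewrite unitmxE det_lblock det_scalar det1 mulr1 unitrX // unitrV unitfE.
move=> x; rewrite -(hsubmxK x) mul_row_block !mulmx0 addr0 add0r mulmx1.
rewrite qf_scale !qf_hyp mulmx_rV1 mxE [X in _ * X * _]mxE eqxx mulr1n.
by field.
Qed.

Lemma bf_mx m n (A : 'M[K]_n) (G : 'M[K]_(m, n)) x y :
  x *m (G *m (A + A^T) *m G^T) *m y^T = (bf A (x *m G) (y *m G))%:M.
Proof. by rewrite [LHS]mx11_scalar /bf trmx_mul !mulmxA. Qed.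

(** [J] is the Gram matrix of the polar form on the rows of [G]; when it is invertible, their
    orthogonal complement is a complementary subspace. *)
Lemma split_regular m n (A : 'M[K]_(m + n)) (G : 'M[K]_(m, m + n)) :
  G *m (A + A^T) *m G^T \in unitmx ->
  exists A' : 'M_n, qf_isometric A (osum (G *m A *m G^T) A').
Proof.
set J := G *m _ *m _ => uJ.
have fG : row_free G.
  apply: row_free_injective => x xG.
  by rewrite -(mulmxK uJ x) /J !mulmxA xG !mul0mx.
have [U uU GU] := row_free_complete fG.
(* [Z] is the Gram-Schmidt correction making the rows of [T] orthogonal to those of [G]; replacing
   [D] by [T] is a unipotent change of basis. *)
pose D := dsubmx U; pose Z := - (D *m (A + A^T) *m G^T *m invmx J).
pose T := Z *m G + D.
exists (T *m A *m T^T).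
have hM : block_mx 1%:M 0 Z 1%:M *m U = col_mx G T.
  by rewrite -{1}(vsubmxK U) GU mul_block_col !mul1mx mul0mx addr0.
exists (col_mx G T).
  by rewrite -hM unitmx_mul uU unitmxE det_lblock !det1 mulr1 unitr1.
move=> x; rewrite -(hsubmxK x); set a := lsubmx x; set b := rsubmx x.
rewrite mul_row_col qfD qf_osum !qf_mul.
suff -> : bf A (a *m G) (b *m T) = 0 by rewrite addr0.
have TC : T *m (A + A^T) *m G^T = 0.
  have -> : T *m (A + A^T) *m G^T = Z *m J + D *m (A + A^T) *m G^T.
    by rewrite /T /J !mulmxDl !mulmxA.
  by rewrite /Z mulNmx mulmxKV // addNr.
rewrite bfC /bf trmx_mul -!mulmxA (mulmxA _ G^T) (mulmxA T) (mulmxA T) TC mul0mx mulmx0.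
by rewrite mxE.
Qed.

Lemma bf_isotropic n (A : 'M[K]_n) v : qf A v = 0 -> bf A v v = 0.
Proof. by move=> e; rewrite bfxx e mulr0. Qed.

Lemma hyperbolic_partner n (A : 'M[K]_n) v u : qf A v = 0 -> bf A v u != 0 ->
  exists2 w, qf A w = 0 & bf A v w = 1.
Proof.
move=> Av vu.
have [w vw] : exists w, bf A v w = 1.
  by exists ((bf A v u)^-1 *: u); rewrite bfZr mulVf.
(* Adding a multiple of [v] keeps the product with [v], since [v] is orthogonal to itself; this
   multiple cancels [qf A w]. *)
exists (w + (- qf A w) *: v).
  by rewrite qfD qfZ Av mulr0 addr0 bfZr bfC vw mulr1 addrN.
by rewrite bfDr bfZr bf_isotropic // mulr0 addr0.
Qed.

Lemma hyperbolic_pair n (A : 'M[K]_n) : isotropic A -> ~ defective A ->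
  exists v u, [/\ qf A v = 0, qf A u = 0 & bf A v u = 1].
Proof.
move=> [v v0 Av] nd.
(* Vanishing on the basis vectors is decidable and already puts [v] in the radical. *)
have [/forallP h|] := boolP [forall j, bf A v (delta_mx 0 j) == 0].
  case: nd; exists v; split=> // y; rewrite (row_sum_delta y).
  apply: (big_ind (fun y => bf A v y = 0)) => [|y1 y2 e1 e2|i _].
  - by rewrite -(scale0r 0) bfZr mul0r.
  - by rewrite bfDr e1 e2 addr0.
  - by rewrite bfZr (eqP (h i)) mulr0.
case/forallPn=> j vj; have [u Au vu] := hyperbolic_partner Av vj.
by exists v, u.
Qed.

Section Pair.
Variables (n : nat) (A : 'M[K]_n) (v u : 'rV[K]_n).
Hypotheses (Av : qf A v = 0) (Au : qf A u = 0) (vu : bf A v u = 1).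
Let G : 'M_(1 + 1, n) := col_mx v u.

(** The Gram matrix exchanges the two coordinates: isotropic vectors are self-orthogonal because
    [bf A v v = 2 qf A v]. *)
Lemma pair_unit : G *m (A + A^T) *m G^T \in unitmx.
Proof.
have bG (a b c d : 'rV[K]_1) :
    bf A (row_mx a b *m G) (row_mx c d *m G) = a 0 0 * d 0 0 + b 0 0 * c 0 0.
  rewrite /G !mul_row_col !mulmx_rV1 !bfDl !bfDr !bfZl !bfZr.
  by rewrite !bf_isotropic // (bfC _ u v) vu; ring.
apply: unitmx_injective => x; rewrite -(hsubmxK x) => e.
have h y : bf A (row_mx (lsubmx x) (rsubmx x) *m G) (y *m G) = 0.
  have := bf_mx A G (row_mx (lsubmx x) (rsubmx x)) y.
  by rewrite e mul0mx => /matrixP/(_ 0 0); rewrite !mxE mulr1n.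
have := h (row_mx 0 1%:M); have := h (row_mx 1%:M 0).
rewrite !bG !mxE !mulr0 addr0 add0r !mulr1 => e1 e2.
have -> : lsubmx x = 0 by apply: rV1_eq0; rewrite mxE.
have -> : rsubmx x = 0 by apply: rV1_eq0; rewrite mxE.
by rewrite row_mx0.
Qed.

Lemma pair_dim : (1 < n)%N.
Proof.
have := pair_unit; rewrite -row_free_unit /row_free => /eqP r.
apply: leq_trans (rank_leq_col G).
by rewrite -[X in (X <= _)%N]r -mulmxA mxrankM_maxl.
Qed.

Lemma pair_hyp : qf_isometric (G *m A *m G^T) (hyp K).
Proof.
apply: qf_isometric_refl => x; rewrite -(hsubmxK x) -qf_mul mul_row_col !mulmx_rV1.
rewrite qfD !qfZ Av Au bfZl bfZr vu qf_hyp; ring.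
Qed.
End Pair.

Lemma split_hyperbolic n (A : 'M[K]_(1 + 1 + n)) : isotropic A -> ~ defective A ->
  exists A' : 'M_n, qf_isometric A (osum (hyp K) A').
Proof.
move=> iA /(hyperbolic_pair iA) [v [u [Av Au vu]]].
have [A' AA'] := split_regular (pair_unit Av Au vu).
exists A'; apply: qf_isometric_trans AA' _; apply: qf_isometric_osum.
  exact: pair_hyp.
exact: qf_isometric_refl.
Qed.

(** A vector of the radical is orthogonal to everything, so any complement of its line is an
    orthogonal one. *)
Lemma split_defective n (A : 'M[K]_(1 + n)) : defective A ->
  exists A' : 'M_n, qf_isometric A (osum (0 : 'M_1) A').
Proof.
move=> [v [v0 Av bv]].
have fv : row_free v by rewrite /row_free rank_rV v0.
have [U uU vU] := row_free_complete fv; pose D := dsubmx U.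
exists (D *m A *m D^T); exists U => // x.
rewrite -(hsubmxK x) -(vsubmxK U) vU mul_row_col qf_osum mulmx_rV1 qfD qfZ Av bfZl bv.
by rewrite qf_zero qf_mul; ring.
Qed.

(** For any column [z], applying [P] to [(y z, y)] and dropping the first coordinate respects the
    forms, because that coordinate carries the zero form. It remains to choose [z] so that this map
    is injective. *)
Lemma cancel_defective n (A B : 'M[K]_n) :
  qf_isometric (osum (0 : 'M_1) A) (osum (0 : 'M_1) B) -> qf_isometric A B.
Proof.
case=> P uP h; pose P' := drsubmx P; pose r := ursubmx P.
have rP (a : 'rV_1) (y : 'rV_n) : rsubmx (row_mx a y *m P) = a *m r + y *m P' by exact: rsubmx_mul.
suff [z uz] : exists z : 'cV_n, P' + z *m r \in unitmx.
  exists (P' + z *m r) => // y.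
  rewrite mulmxDr mulmxA addrC -rP.
  rewrite -[LHS]add0r -(qf_zero (lsubmx (row_mx (y *m z) y *m P))) -qf_osum hsubmxK h.
  by rewrite qf_osum qf_zero add0r.
have [uP'|] := boolP (P' \in unitmx); first by exists 0; rewrite mul0mx addr0.
rewrite -row_free_unit -kermx_eq0 => /rowV0Pn [y0 /sub_kermxP y0P y00].
have [i yi] : exists i, y0 0 i != 0.
  apply/existsP; apply: contraNT y00; rewrite negb_exists => /forallP e.
  by apply/eqP/rowP => j; rewrite mxE; apply/eqP; have := e j; rewrite negbK.
(* [P] sends [(0, y0)] into the first axis, so any [(y z, y)] sent there is a multiple of [(0, y0)].
   Then [y z = 0], and with [z] the coordinate [i], nonzero at [y0], this forces [y = 0]. *)
exists (delta_mx i 0); apply: unitmx_injective => y.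
rewrite mulmxDr mulmxA addrC -rP; set a := y *m _ => e.
have e0 : rsubmx (row_mx 0 y0 *m P) = 0 by rewrite rP mul0mx y0P addr0.
set s := lsubmx (row_mx 0 y0 *m P); set t := lsubmx (row_mx a y *m P).
have es : row_mx 0 y0 *m P = row_mx s 0 by rewrite -(hsubmxK (_ *m P)) e0.
have et : row_mx a y *m P = row_mx t 0 by rewrite -(hsubmxK (_ *m P)) e.
have s0 : s 0 0 != 0.
  apply: contraNneq y00 => /rV1_eq0 s0; rewrite s0 row_mx0 in es.
  have : row_mx 0 y0 = 0 :> 'rV_(1 + n) by rewrite -(mulmxK uP (row_mx 0 y0)) es mul0mx.
  by rewrite -[0 in RHS]row_mx0 => /eq_row_mx [_ ->].
have : row_mx a y = row_mx 0 ((t 0 0 / s 0 0) *: y0).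
  rewrite -[LHS](mulmxK uP) et -[RHS](mulmxK uP); congr (_ *m _).
  rewrite -[0 in RHS](scaler0 _ (t 0 0 / s 0 0)) -scale_row_mx -scalemxAl es.
  rewrite scale_row_mx scaler0; congr row_mx.
  by apply/rowP => j; rewrite ord1 [RHS]mxE divfK.
case/eq_row_mx => a0 ey; move: a0; rewrite /a ey.
move=> /rowP/(_ 0); rewrite -scalemxAl -colE [LHS]mxE [col _ _ _ _]mxE [RHS]mxE => /eqP.
by rewrite mulf_eq0 (negPf yi) orbF => /eqP ->; rewrite scale0r.
Qed.

(** Acting on rows from the right, this is the reflection in [w], which in characteristic 2 is an
    orthogonal transvection. *)
Definition reflect_mx n (A : 'M[K]_n) (w : 'rV[K]_n) : 'M_n :=
  1%:M - (qf A w)^-1 *: ((A + A^T) *m w^T *m w).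

Lemma reflect_mxE n (A : 'M[K]_n) w x :
  x *m reflect_mx A w = x - (bf A x w / qf A w) *: w.
Proof.
rewrite /reflect_mx mulmxBr mulmx1 -scalemxAr !mulmxA mulmx_rV1 -/(bf A x w).
by rewrite scalerA mulrC.
Qed.

Lemma qf_reflect n (A : 'M[K]_n) w x :
  qf A w != 0 -> qf A (x *m reflect_mx A w) = qf A x.
Proof.
move=> w0; rewrite reflect_mxE -scaleNr qfD qfZ bfZr.
by field.
Qed.

Lemma reflect_mx_unit n (A : 'M[K]_n) w : qf A w != 0 -> reflect_mx A w \in unitmx.
Proof.
move=> w0; suff : reflect_mx A w *m reflect_mx A w = 1%:M by case/mulmx1_unit.
apply/row_matrixP => i; rewrite !rowE mulmxA mulmx1 !reflect_mxE.
set b := bf A _ w; have -> : bf A (delta_mx 0 i - (b / qf A w) *: w) w = - b.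
  by rewrite -scaleNr bfDl bfZl bfxx -/b; field.
by rewrite mulNr scaleNr opprK subrK.
Qed.

Definition regular_zero n (A : 'M[K]_n) v := qf A v = 0 /\ exists y, bf A v y != 0.

(* Reflection in [v - w] when [v], [w] are not orthogonal; otherwise go
   through an isotropic vector orthogonal to neither. *)
Lemma isotropic_transitive n (A : 'M[K]_n) v w :
  regular_zero A v -> regular_zero A w ->
  exists T, [/\ T \in unitmx, forall x, qf A (x *m T) = qf A x & v *m T = w].
Proof.
have step x y : qf A x = 0 -> qf A y = 0 -> bf A x y != 0 ->
    exists T, [/\ T \in unitmx, forall z, qf A (z *m T) = qf A z & x *m T = y].
  move=> Ax Ay xy; have qxy : qf A (x - y) = - bf A x y.
    by rewrite -[- y]scaleN1r qfD qfZ bfZr Ax Ay; ring.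
  have nz : qf A (x - y) != 0 by rewrite qxy oppr_eq0.
  exists (reflect_mx A (x - y)); split.
  - exact: reflect_mx_unit.
  - by move=> z; rewrite qf_reflect.
  - rewrite reflect_mxE qxy -[- y]scaleN1r bfDr bfZr bf_isotropic // add0r mulN1r.
    by rewrite divff ?oppr_eq0 // scale1r scaleN1r opprB addrC subrK.
move=> [Av [a va]] [Aw [b wb]].
(* If neither [a] nor [b] serves, [a] is orthogonal to [w] and [b] to [v], so [a + b] serves. *)
have [z [vz wz]] : exists z, bf A v z != 0 /\ bf A w z != 0.
  have [wa|wa] := eqVneq (bf A w a) 0; last by exists a.
  have [vb|vb] := eqVneq (bf A v b) 0; last by exists b.
  by exists (a + b); rewrite !bfDr wa vb addr0 add0r.
have [vw|vw] := eqVneq (bf A v w) 0; last exact: step.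
(* The multiple of [v] makes [u] isotropic without changing the products with [v] and [w], both
   orthogonal to [v]. *)
pose u := z - (qf A z / bf A v z) *: v.
have Au : qf A u = 0.
  by rewrite /u -scaleNr qfD qfZ Av bfZr (bfC _ z); field.
have uv : bf A v u != 0 by rewrite /u -scaleNr bfDr bfZr bf_isotropic // mulr0 addr0.
have uw : bf A u w != 0.
  by rewrite bfC /u -scaleNr bfDr bfZr (bfC _ w v) vw mulr0 addr0.
have [T [uT hT vT]] := step _ _ Av Au uv; have [T' [uT' hT' uT'']] := step _ _ Au Aw uw.
exists (T *m T'); split; first by rewrite unitmx_mul uT.
  by move=> x; rewrite mulmxA hT' hT.
by rewrite mulmxA vT.
Qed.

(** By transitivity the isometry can be corrected to fix [e]. It then preserves the orthogonal
    complement of [e], whose quotient by the line of [e] carries [B] at the source and [A] at the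
    target. *)
Lemma cancel_hyperbolic n (A B : 'M[K]_n) :
  qf_isometric (osum (hyp K) A) (osum (hyp K) B) -> qf_isometric A B.
Proof.
case=> P uP h; pose e : 'rV[K]_(1 + 1 + n) := row_mx (row_mx 1%:M 0) 0.
have be (D : 'M[K]_n) (a b : 'rV[K]_1) (c : 'rV[K]_n) :
    bf (osum (hyp K) D) e (row_mx (row_mx a b) c) = b 0 0.
  rewrite bf_qf /e !add_row_mx !add0r !qf_osum !qf_hyp qf0.
  by rewrite !mxE !eqxx mulr1n; ring.
have ze D : regular_zero (osum (hyp K) D) e.
  split; first by rewrite /e qf_osum qf_hyp qf0 [X in _ * X]mxE mulr0 addr0.
  by exists (row_mx (row_mx 0 1%:M) 0); rewrite be mxE oner_neq0.
have zP : regular_zero (osum (hyp K) A) (e *m P).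
  have [q0 [y ey]] := ze B; split; first by rewrite h.
  by exists (y *m P); rewrite (bf_iso h).
have [T [uT hT eT]] := isotropic_transitive zP (ze A).
pose Q := P *m T; have uQ : Q \in unitmx by rewrite unitmx_mul uP.
have hQ x : qf (osum (hyp K) A) (x *m Q) = qf (osum (hyp K) B) x.
  by rewrite mulmxA hT h.
have eQ : e *m Q = e by rewrite mulmxA.
have Qy y : exists a : 'rV_1, row_mx 0 y *m Q = row_mx (row_mx a 0) (y *m drsubmx Q).
  have : bf (osum (hyp K) B) e (row_mx 0 y) = 0 by have := be B 0 0 y; rewrite row_mx0 mxE.
  rewrite -(bf_iso hQ) eQ -{1}(hsubmxK (row_mx 0 y *m Q)) -{1}(hsubmxK (lsubmx _)) be.
  move/rV1_eq0 => r0; exists (lsubmx (lsubmx (row_mx 0 y *m Q))).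
  rewrite -{1}(hsubmxK (row_mx 0 y *m Q)) -{1}(hsubmxK (lsubmx _)) r0.
  by rewrite rsubmx_mul mul0mx add0r.
exists (drsubmx Q).
  apply: unitmx_injective => y y0; have [a] := Qy y; rewrite y0 => ey.
  have : row_mx 0 y *m Q = (a 0 0 *: e) *m Q.
    by rewrite -scalemxAl eQ ey /e !scale_row_mx !scaler0 -mulmx_rV1 mulmx1.
  move/(can_inj (mulmxK uQ)); rewrite /e !scale_row_mx !scaler0.
  by case/eq_row_mx.
move=> y; have [a ey] := Qy y.
have := hQ (row_mx 0 y); rewrite ey !qf_osum qf_hyp qf0 add0r [X in _ * X]mxE.
by rewrite mulr0 add0r.
Qed.

End Witt.

(** * Forms over polynomials *)

Definition anisotropic (K : fieldType) n (A : 'M[K]_n) : Prop :=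
  forall v, qf A v = 0 -> v = 0.

Definition qp (K : fieldType) n (A : 'M[K]_n) (v : 'rV[{poly K}]_n) : {poly K} :=
  (v *m map_mx polyC A *m v^T) 0 0.

Definition coefv (K : fieldType) n k (v : 'rV[{poly K}]_n) : 'rV[K]_n :=
  map_mx (coefp k) v.

Section PolyForms.
Variables (F : fieldType) (n : nat).
Implicit Types (A B : 'M[F]_n) (v w : 'rV[{poly F}]_n) (p q g h : {poly F}).

Lemma qpE A v : qp A v = \sum_j \sum_i (A i j)%:P * (v 0 i * v 0 j).
Proof.
rewrite /qp mxE; apply: eq_bigr => j _; rewrite !mxE mulr_suml.
by apply: eq_bigr => i _; rewrite !mxE; ring.
Qed.

Lemma qfE A (x : 'rV_n) : qf A x = \sum_j \sum_i A i j * (x 0 i * x 0 j).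
Proof.
rewrite /qf mxE; apply: eq_bigr => j _; rewrite !mxE mulr_suml.
by apply: eq_bigr => i _; ring.
Qed.

Lemma qp0 A : qp A 0 = 0.
Proof. by rewrite /qp !mul0mx mxE. Qed.

Lemma coefM_top p q d e : (size p <= d.+1)%N -> (size q <= e.+1)%N ->
  (p * q)`_(d + e) = p`_d * q`_e.
Proof.
move=> sp sq; have ld : (d < (d + e).+1)%N by rewrite ltnS leq_addr.
rewrite coefM (bigD1 (Ordinal ld)) //= addKn big1 ?addr0 // => i.
rewrite -val_eqE /= => ne; have [li|li] := ltnP i d.
  by rewrite [q`_ _]nth_default ?mulr0 //; apply: leq_trans sq _; lia.
by rewrite nth_default ?mul0r //; apply: leq_trans sp _; lia.
Qed.

Lemma coef_qp A v d : (forall i, size (v 0%R i) <= d.+1)%N ->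
  (qp A v)`_(d + d) = qf A (coefv d v).
Proof.
move=> sv; rewrite qpE qfE coef_sum; apply: eq_bigr => j _; rewrite coef_sum.
by apply: eq_bigr => i _; rewrite coefCM coefM_top // !mxE.
Qed.

Lemma coef0_qp A v : (qp A v)`_0 = qf A (coefv 0 v).
Proof.
rewrite qpE qfE coef_sum; apply: eq_bigr => j _; rewrite coef_sum.
by apply: eq_bigr => i _; rewrite coefCM coef0M !mxE.
Qed.

Lemma size_qp A v d : (forall i, size (v 0%R i) <= d.+1)%N ->
  (size (qp A v) <= (d + d).+1)%N.
Proof.
move=> sv; rewrite qpE; apply: (leq_trans (size_sum _ _ _)).
apply/bigmax_leqP => j _; apply: (leq_trans (size_sum _ _ _)).
apply/bigmax_leqP => i _; rewrite mul_polyC.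
apply: (leq_trans (size_scale_leq _ _)); apply: (leq_trans (size_polyMleq _ _)).
by have := sv i; have := sv j; lia.
Qed.

(** The vector of coefficients in the maximal degree [d] is nonzero, so by anisotropy the
    coefficient of degree [2d] survives: nonzero vectors take values of even degree. *)
Lemma anisotropic_size_qp A v : anisotropic A -> v != 0 ->
  exists d, [/\ forall i, (size (v 0%R i) <= d.+1)%N,
                exists i, size (v 0 i) = d.+1 & size (qp A v) = (d + d).+1].
Proof.
move=> aA v0.
have [i0 vi0] : exists i, v 0 i != 0.
  apply/existsP; apply: contraNT v0; rewrite negb_exists => /forallP e.
  by apply/eqP/rowP => j; rewrite mxE; apply/eqP; have := e j; rewrite negbK.
have [i _ imax] := @arg_maxnP _ i0 xpredT (fun i => size (v 0 i)) isT.
have vi : v 0 i != 0.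
  by rewrite -size_poly_gt0 (leq_trans _ (imax i0 isT)) ?size_poly_gt0.
exists (size (v 0 i)).-1; have sv : size (v 0 i) = (size (v 0 i)).-1.+1.
  by rewrite prednK // size_poly_gt0.
set d := (size (v 0 i)).-1 in sv *.
have le j : (size (v 0%R j) <= d.+1)%N by rewrite -sv; exact: imax.
split=> //; first by exists i.
apply/eqP; rewrite eqn_leq size_qp //=; apply: contraTT isT.
rewrite -leqNgt => sq; have := coef_qp A le; rewrite nth_default // => /esym/aA.
move/rowP/(_ i); rewrite !mxE /= /d => /eqP.
by rewrite -lead_coefE lead_coef_eq0 (negPf vi).
Qed.

Lemma dvdp_mulmx_row m p (u : 'rV[{poly F}]_m) (M : 'cV_m) :
  (forall i, p %| u 0 i) -> p %| (u *m M) 0 0.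
Proof.
move=> pu; rewrite mxE; apply: (big_ind (fun f => p %| f)) => [|f g|i _].
- exact: dvdp0.
- exact: dvdp_add.
- exact: dvdp_mulr.
Qed.

Lemma dvdp_qpB A p v w : (forall i, p %| v 0 i - w 0 i) -> p %| qp A v - qp A w.
Proof.
move=> pvw; have pu i : p %| (v - w) 0 i by rewrite !mxE.
(* With [a] the bilinear form of matrix [A], this is [a(v - w, v) + a(w, v - w)], the last term
   being transposed. *)
have -> : qp A v - qp A w =
    ((v - w) *m (map_mx polyC A *m v^T)) 0 0 +
    ((v - w) *m ((map_mx polyC A)^T *m w^T)) 0 0.
  have -> : ((v - w) *m ((map_mx polyC A)^T *m w^T)) 0 0 =
            (w *m map_mx polyC A *m (v - w)^T) 0 0.
    by rewrite -mx11_tr !trmx_mul !trmxK.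
  rewrite linearB /= mulmxBl mulmxBr /qp -!mulmxA.
  by rewrite !submx00; ring.
by apply: dvdp_add; apply: dvdp_mulmx_row.
Qed.

Lemma qpZ A g v : qp A (g *: v) = g ^+ 2 * qp A v.
Proof. by rewrite /qp linearZ /= -!scalemxAl -scalemxAr mxE [X in g * X]mxE mulrA. Qed.

Lemma gcd_row v : exists g, (forall i, g %| v 0 i) /\
  forall h, (forall i, h %| v 0 i) -> h %| g.
Proof.
exists (\big[@gcdp _/0]_(i <- enum 'I_n) v 0 i).
have dv h : (h %| \big[@gcdp _/0]_(i <- enum 'I_n) v 0 i) =
            all (fun i => h %| v 0 i) (enum 'I_n).
  by elim: (enum _) => [|i s IH]; rewrite ?big_nil ?dvdp0 // big_cons dvdp_gcd IH.
split=> [i|h hv]; last by rewrite dv; apply/allP.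
by have := dvdpp (\big[@gcdp _/0]_(i <- enum 'I_n) v 0 i); rewrite dv => /allP->; rewrite ?mem_enum.
Qed.

Definition coprime_row p v := forall g, g %| p -> (forall i, g %| v 0 i) -> g %| 1.

(* Springer's descent: after reducing [v] mod [p] and dividing by its content,
   the cofactor of [p] in [qp A v] again has odd, but smaller, degree. *)
Lemma springer_descent A : anisotropic A -> forall p v,
  p != 0 -> ~~ odd (size p) -> coprime_row p v -> p %| qp A v -> False.
Proof.
move=> aA p; have [k] := ubnP (size p); elim: k p => // k IH p /ltnSE sk v p0 op cpv pv.
pose w : 'rV_n := \row_i (v 0 i %% p).
have vw i : p %| v 0 i - w 0 i.
  by rewrite mxE {1}(divp_eq (v 0 i) p) addrK dvdp_mull.
have pw : p %| qp A w.
  by rewrite -(dvdp_subr _ pv); apply: dvdp_qpB.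
have [g [gw gP]] := gcd_row w.
(* A common factor of [p] and the content [g] of [w] would divide [v] too; hence [g ^+ 2] can be
   cancelled from [p %| qp A w]. *)
have gv h : h %| p -> h %| g -> h %| 1.
  move=> hp hg; apply: cpv => // i; rewrite -(dvdp_subl _ (dvdp_trans hg (gw i))).
  exact: dvdp_trans hp (vw i).
have cpg : coprimep p g.
  by apply/coprimepP => h hp hg; rewrite -size_poly_eq1 -dvdp1 gv.
have g0 : g != 0.
  apply: contraNneq op => g0; suff /eqP -> : size p == 1 by [].
  by rewrite -dvdp1 gv // g0 dvdp0.
have [u wu] : exists u : 'rV_n, w = g *: u.
  exists (\row_i (w 0 i %/ g)); apply/rowP => i.
  by rewrite [RHS]mxE [X in _ * X]mxE mulrC divpK.
have pu : p %| qp A u.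
  by move: pw; rewrite wu qpZ Gauss_dvdpr // coprimep_pexpr.
have u1 h : (forall i, h %| u 0 i) -> h %| 1.
  move=> hu; rewrite -(dvdp_mul2l _ _ g0) mulr1; apply: gP => i.
  by rewrite wu mxE dvdp_mul2l.
have u0 : u != 0.
  apply: contraTneq (oner_neq0 F) => u0; rewrite negbK.
  by have := u1 0; rewrite dvd0p polyC_eq0; apply => i; rewrite u0 mxE dvdpp.
have [d [su [i si] sq]] := anisotropic_size_qp aA u0.
have sud : (d.+1 < size p)%N.
  rewrite -si; apply: leq_ltn_trans (_ : size (w 0%R i) < size p)%N; last first.
    by rewrite mxE ltn_modp.
  have ui0 : u 0 i != 0 by rewrite -size_poly_gt0 si.
  have -> : w 0 i = g * u 0 i by rewrite {1}wu mxE.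
  rewrite size_mul //; move: g0; rewrite -size_poly_gt0 -subn1.
  by case: size => // k0 _; rewrite addSn subn1 leq_addl.
have h0 : qp A u %/ p != 0.
  by apply: contraPneq sq => e; rewrite -(divpK pu) e mul0r size_poly0.
(* Sizes being degrees plus one, the cofactor has degree [2d - deg p], which is below [deg p]
   because [d < deg p]. *)
have sh : (size (qp A u %/ p)%R + size p = (d + d).+2)%N.
  rewrite -{1}sq -{2}(divpK pu) size_mul // prednK //.
  by rewrite addn_gt0 size_poly_gt0 h0.
apply: (IH _ _ u h0); first (by move: sk sud sh; clear; move: (size p) (size (_ %/ _)) => a b; lia).
- by move: op (congr1 odd sh); rewrite oddD /= addnn odd_double; do 2!case: odd.
- by move=> h _ hu; apply: u1.
- by rewrite -{2}(divpK pu) dvdp_mulr.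
Qed.

End PolyForms.

(** * Descent along a simple extension of odd degree *)

Section Descent.
Variables (F : fieldType) (n d : nat) (A B : 'M[F]_n).
Variables (p : {poly F}) (S : 'M[{poly F}]_n).
Hypotheses (aA : anisotropic A) (aB : anisotropic B).
Hypotheses (pm : p \is monic) (sp : size p = (d + d).+2) (p00 : p`_0 != 0).
(** Modulo [p], [S] stands for the isometry and ['X] for the generator [x], so that the isometry
    becomes a divisibility between polynomials. *)
Hypothesis pS : forall v w, (forall i, p %| (v - w *m S) 0 i) ->
  p %| qp A v - 'X * qp B w.

(** Encoding vectors of polynomials of bounded degree by their coefficient matrices gives a
    finite-dimensional space, where dimensions can be counted. *)
Definition rowpoly m (V : 'M[F]_(n, m)) : 'rV[{poly F}]_n :=
  \row_i rVpoly (row i V).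

Lemma rowpolyP m c (V W : 'M_(n, m)) :
  rowpoly (c *: V + W) = c%:P *: rowpoly V + rowpoly W.
Proof. by apply/rowP => i; rewrite !mxE !linearP /= mul_polyC. Qed.

Lemma size_rowpoly m (V : 'M_(n, m)) i : (size (rowpoly V 0%R i) <= m)%N.
Proof. by rewrite mxE size_poly. Qed.

Lemma rowpoly_inj m (V : 'M_(n, m)) : rowpoly V = 0 -> V = 0.
Proof.
move=> e; apply/row_matrixP => i; rewrite row0 -[LHS]rVpolyK.
by move/rowP/(_ i): e; rewrite !mxE => ->; rewrite linear0.
Qed.

Let VW := ('M[F]_(n, d.+1) * 'M[F]_(n, d.+1))%type.

(** When [p] is the minimal polynomial of [x] and [S] lifts [sigma], the kernel consists of the
    pairs with [v(x) = sigma(w(x))]. *)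
Definition defect (z : VW) : 'M[F]_(n, (d + d).+1) :=
  \matrix_i poly_rV ((rowpoly z.1 - rowpoly z.2 *m S) 0 i %% p).
Definition low (z : VW) : 'rV[F]_n := coefv 0 (rowpoly z.1).
Definition top (z : VW) : 'rV[F]_n := coefv d (rowpoly z.2).

Fact defect_linear : linear defect.
Proof.
move=> c z z'; apply/row_matrixP => i; rewrite linearP /= !rowK -linearP /=.
congr (poly_rV _); rewrite -modpZl -modpD -mul_polyC; congr (_ %% _).
rewrite !rowpolyP mulmxDl -scalemxAl opprD addrACA -scalerBr.
by rewrite [LHS]mxE [X in X + _]mxE.
Qed.
HB.instance Definition _ := GRing.isLinear.Build F VW _ _ defect defect_linear.

Fact low_linear : linear low.
Proof.
by move=> c z z'; rewrite /low rowpolyP; apply/rowP => i; rewrite !mxE /= coefD coefCM.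
Qed.
HB.instance Definition _ := GRing.isLinear.Build F VW _ _ low low_linear.

Fact top_linear : linear top.
Proof.
by move=> c z z'; rewrite /top rowpolyP; apply/rowP => i; rewrite !mxE /= coefD coefCM.
Qed.
HB.instance Definition _ := GRing.isLinear.Build F VW _ _ top top_linear.

Let Z := lker (linfun defect).

Lemma defect_mod z : z \in Z -> exists c,
  qp A (rowpoly z.1) - 'X * qp B (rowpoly z.2) = c *: p.
Proof.
rewrite memv_ker lfunE /= => /eqP z0.
have /dvdpP[h hE] : p %| qp A (rowpoly z.1) - 'X * qp B (rowpoly z.2).
  apply: pS => i; have sm : (size ((rowpoly z.1 - rowpoly z.2 *m S) 0%R i %% p)%R <= (d + d).+1)%N.
    by rewrite -ltnS -sp ltn_modp monic_neq0.
  have := congr1 (row i) z0; rewrite rowK row0 => e.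
  by have := poly_rV_K sm; rewrite e linear0 /dvdp => <-.
(* The two terms have degrees at most [2d] and [2d+1 = deg p], so the cofactor is constant. *)
have sh : (size h <= 1)%N.
  have [->|h0] := eqVneq h 0; first by rewrite size_poly0.
  have := congr1 (fun q : {poly F} => size q) hE.
  rewrite [X in _ = X]size_mul ?(monic_neq0 pm) // sp.
  have : (size (qp A (rowpoly z.1) - 'X * qp B (rowpoly z.2))%R <= (d + d).+2)%N.
    apply: leq_trans (size_polyD _ _) _; rewrite geq_max size_polyN.
    rewrite (leq_trans (size_qp A (size_rowpoly _))) //=.
    apply: leq_trans (size_polyMleq _ _) _; rewrite size_polyX /= ltnS.
    exact: (size_qp B (size_rowpoly _)).
  by move=> h1 h2; move: h1; rewrite h2 !addnS /= !ltnS; move: (size h) => k; lia.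
by exists h`_0; rewrite hE {1}(size1_polyC sh) mul_polyC.
Qed.

Lemma low_top z : z \in Z -> qf A (low z) = - p`_0 * qf B (top z).
Proof.
move=> /defect_mod [c e].
have e0 : qf A (low z) = c * p`_0.
  by have := congr1 (coefp 0) e; rewrite /= coefB coefXM subr0 coef0_qp coefZ.
(* In degree [2d+1] the form [A] contributes nothing and [p] has coefficient 1. *)
have et : - qf B (top z) = c.
  have := congr1 (coefp (d + d).+1) e; rewrite /= coefB coefXM /= coefZ.
  rewrite (coef_qp _ (size_rowpoly _)) nth_default; last first.
    exact: size_qp (size_rowpoly _).
  by move/monicP: pm; rewrite lead_coefE sp /= => ->; rewrite mulr1 sub0r.
by rewrite e0 -et; ring.
Qed.

(** If [w_d = 0], then [v_0 = 0] by anisotropy of [A], so [c = 0] because [p(0)] is nonzero. In the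
    remaining equation one side has even and the other odd degree, unless both vanish. *)
Lemma top_inj z : z \in Z -> top z = 0 -> z = 0.
Proof.
move=> zZ t0; have l0 : low z = 0 by apply: aA; rewrite low_top // t0 qf0 mulr0.
have [c e] := defect_mod zZ.
have c0 : c = 0.
  apply/eqP; have := congr1 (coefp 0) e; rewrite /= coefB coefXM subr0 coef0_qp.
  by rewrite -/(low z) l0 qf0 coefZ => /esym/eqP; rewrite mulf_eq0 (negPf p00) orbF.
move: e; rewrite c0 scale0r => /eqP; rewrite subr_eq0 => /eqP e.
suff [z1 z2] : rowpoly z.1 = 0 /\ rowpoly z.2 = 0.
  by rewrite [z]surjective_pairing (rowpoly_inj z1) (rowpoly_inj z2).
have z2 : rowpoly z.2 = 0.
  apply/eqP; case: eqP => // /eqP z20.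
  have [k [_ _ sk]] := anisotropic_size_qp aB z20.
  have sX : size ('X * qp B (rowpoly z.2)) = (k + k).+2.
    by rewrite mulrC size_mulX -?size_poly_gt0 sk.
  have [z10|z10] := eqVneq (rowpoly z.1) 0.
    by move: sX; rewrite -e z10 qp0 size_poly0.
  have [l [_ _ sl]] := anisotropic_size_qp aA z10.
  by move: sX; rewrite -e sl; lia.
split=> //; apply/eqP; case: eqP => // /eqP z10.
have [l [_ _ sl]] := anisotropic_size_qp aA z10.
by move: sl; rewrite e z2 qp0 mulr0 size_poly0.
Qed.

Lemma top_surj y : exists2 z, z \in Z & top z = y.
Proof.
(* The pairs have dimension [2n(d+1)] and the remainders [n(2d+1)], which leaves a kernel of
   dimension at least [n]. *)
have dZ : (n <= \dim Z)%N.
  have := limg_ker_dim (linfun defect) fullv; rewrite capfv -/Z dimvf /dim /=.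
  have := dimvS (subvf (limg (linfun defect))); rewrite dimvf /dim /=.
  by move: (\dim Z) (\dim _) => a b; lia.
have iZ : (Z :&: lker (linfun top) = 0)%VS.
  apply/eqP; rewrite -subv0; apply/subvP => z; rewrite memv_cap memv_ker lfunE /=.
  by case/andP=> zZ /eqP /(top_inj zZ) ->; rewrite mem0v.
have : y \in (linfun top @: Z)%VS.
  suff /eqP -> : (linfun top @: Z)%VS == fullv by rewrite memvf.
  by rewrite eqEdim subvf dimvf limg_dim_eq // /dim /= mul1n.
by case/memv_imgP => z zZ ->; exists z; rewrite ?lfunE.
Qed.

Lemma descent_isometric : qf_isometric A (- p`_0 *: B).
Proof.
have /fin_all_exists2 [z zZ zt] : forall i : 'I_n, exists2 z, z \in Z & top z = delta_mx 0 i.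
  by move=> i; exact: top_surj.
pose P := \matrix_i low (z i).
have h x : qf A (x *m P) = qf (- p`_0 *: B) x.
  pose zx := \sum_i x 0 i *: z i.
  have zxZ : zx \in Z by apply: memv_suml => i _; apply: memvZ.
  have -> : x *m P = low zx.
    rewrite linear_sum mulmx_sum_row; apply: eq_bigr => i _.
    by rewrite rowK linearZ.
  rewrite low_top // qf_scale; congr (_ * qf _ _).
  rewrite linear_sum [RHS]row_sum_delta; apply: eq_bigr => i _.
  by rewrite linearZ /= zt.
(* A vector killed by [P] is a zero of [B], since [p(0)] is nonzero. *)
exists P => //; apply: unitmx_injective => x xP; apply: aB; apply/eqP.
by have := h x; rewrite xP qf0 qf_scale => /esym/eqP; rewrite mulf_eq0 oppr_eq0 (negPf p00).
Qed.

End Descent.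

(** * Scalar extension *)

(** This says that [E = F(x)] has odd degree (even [size]) with minimal polynomial [p], for an
    arbitrary embedding [iota], so that [E] may be a subfield of [L] as well as [L] itself. *)
Definition odd_generator (F E : fieldType) (iota : {rmorphism F -> E})
    (x : E) (p : {poly F}) : Prop :=
  [/\ p \is monic, ~~ odd (size p),
      forall q, root (map_poly iota q) x = (p %| q)
    & forall y, exists q, y = (map_poly iota q).[x]].

Section Extension.
Variables (F E : fieldType) (iota : {rmorphism F -> E}).
Implicit Types (n : nat).

Lemma qf_map n (A : 'M[F]_n) v : qf (map_mx iota A) (map_mx iota v) = iota (qf A v).
Proof. by rewrite /qf map_trmx -!map_mxM mxE. Qed.

Lemma osum_map m n (A : 'M[F]_m) (B : 'M[F]_n) :
  map_mx iota (osum A B) = osum (map_mx iota A) (map_mx iota B).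
Proof. by rewrite /osum map_block_mx !raddf0. Qed.

Lemma hyp_map : map_mx iota (hyp F) = hyp E.
Proof. by rewrite /hyp map_block_mx !raddf0 map_mx1. Qed.

Lemma isotropic_map n (A : 'M[F]_n) : isotropic A -> isotropic (map_mx iota A).
Proof.
by case=> v v0 Av; exists (map_mx iota v); rewrite ?map_mx_eq0 // qf_map Av rmorph0.
Qed.

(** An alternating matrix is [T - T^T] with [T] its strictly upper part, and [T], [T^T] define the
    same form. *)
Lemma alternating_qf0 n (D : 'M[E]_n) (x : 'rV_n) :
  (forall i, D i i = 0) -> D + D^T = 0 -> qf D x = 0.
Proof.
move=> D0 DT; pose T : 'M[E]_n := \matrix_(i, j) if (i < j)%N then D i j else 0.
have -> : D = T - T^T.
  apply/matrixP => i j; rewrite !mxE; case: ltngtP => [_|_|/val_inj ->].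
  - by rewrite subr0.
  - by have /matrixP/(_ i j)/eqP := DT; rewrite !mxE addr_eq0 sub0r => /eqP.
  - by rewrite D0 subrr.
rewrite /qf mulmxBr mulmxBl submx00 -[X in _ - X]mx11_tr !trmx_mul !trmxK mulmxA.
exact: subrr.
Qed.

(* Equality of the values on [F^n] forces the difference to be alternating,
   even when [F] is finite. *)
Lemma qf_isometric_map n (A B : 'M[F]_n) :
  qf_isometric A B -> qf_isometric (map_mx iota A) (map_mx iota B).
Proof.
case=> P uP h; exists (map_mx iota P); first by rewrite map_unitmx.
move=> x; rewrite qf_mul map_trmx -!map_mxM.
set C := P *m A *m P^T; have {}h y : qf C y = qf B y by rewrite -qf_mul.
have entry (M : 'M[F]_n) i j : (delta_mx 0 i *m M *m (delta_mx 0 j)^T : 'M_1) 0 0 = M i j.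
  by rewrite -rowE trmx_delta -colE !mxE.
pose D := C - B; have hq y : qf D y = 0.
  by rewrite /qf /D mulmxBr mulmxBl submx00 -!/(qf _ _) h subrr.
have D0 i : D i i = 0 by rewrite -(entry D); apply: hq.
have DT : D + D^T = 0.
  by apply/matrixP => i j; rewrite -entry -/(bf _ _ _) bf_qf !hq !subr0 mxE.
have : qf (map_mx iota D) x = 0.
  apply: alternating_qf0 => [i|]; first by rewrite mxE D0 rmorph0.
  by rewrite map_trmx -map_mxD DT raddf0.
rewrite /D map_mxB /qf mulmxBr mulmxBl submx00 => /eqP.
by rewrite subr_eq0 => /eqP.
Qed.

Section Odd.
Variables (x : E) (p : {poly F}).
Hypothesis xp : odd_generator iota x p.

Definition evalv n (v : 'rV[{poly F}]_n) : 'rV[E]_n :=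
  map_mx (horner_eval x \o map_poly iota) v.

Lemma qp_horner n (A : 'M[F]_n) v :
  (map_poly iota (qp A v)).[x] = qf (map_mx iota A) (evalv v).
Proof.
rewrite /qf /evalv map_trmx.
have -> : map_mx iota A = map_mx (horner_eval x \o map_poly iota) (map_mx polyC A).
  by apply/matrixP => i j; rewrite !mxE /= map_polyC /horner_eval hornerC.
by rewrite -!map_mxM mxE.
Qed.

Lemma evalv_surj n (y : 'rV[E]_n) : exists v, y = evalv v.
Proof.
have [_ _ _ sx] := xp.
have /fin_all_exists [v yv] : forall i, exists q, y 0 i = (map_poly iota q).[x].
  by move=> i; exact: sx.
by exists (\row_i v i); apply/rowP => i; rewrite !mxE.
Qed.

(** A zero over [E] lifts to a polynomial vector [v] with [p %| qp A v]. If [p = h * g] with [g]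
    dividing [v], then [x] is a root of [g], and [v(x) = 0], or of [h], and [g] is constant; so the
    descent applies when [v(x)] is nonzero. *)
Lemma springer n (A : 'M[F]_n) : anisotropic A -> anisotropic (map_mx iota A).
Proof.
have [pm op rp _] := xp; have p0 := monic_neq0 pm.
move=> aA y; have [v ->] := evalv_surj y; rewrite -qp_horner => /rootP.
rewrite rp => pv; apply/eqP; apply: contraT => v0; exfalso.
apply: (springer_descent aA p0 op _ pv) => g /dvdpP [h ph] gv.
have : root (map_poly iota p) x by rewrite rp.
rewrite ph rmorphM rootM !rp => /orP [hp|gp]; last first.
  case/eqP: v0; apply/rowP => i; rewrite !mxE /=; apply/rootP.
  by rewrite rp (dvdp_trans gp).
have h0 : h != 0 by apply: contraNneq p0 => h0; rewrite ph h0 mul0r.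
rewrite dvdp1; have := dvdp_leq h0 hp.
have g0 : g != 0 by apply: contraNneq p0 => g0; rewrite ph g0 mulr0.
rewrite ph size_mul //; move: g0 h0; rewrite -!size_poly_gt0.
by move: (size g) (size h) => a b; lia.
Qed.

(** Otherwise [p = q * 'X], and the nonzero [x] is a root of the smaller [q]. *)
Lemma odd_generator_coef0 : x != 0 -> p`_0 != 0.
Proof.
have [pm op rp _] := xp; move=> x0; apply/negP => /eqP p0.
have : root p 0 by rewrite /root horner_coef0 p0.
case/factor_theorem => q; rewrite subr0 => pq.
have q0 : q != 0 by apply: contraTneq (monic_neq0 pm) => q0; rewrite pq q0 mul0r eqxx.
have : root (map_poly iota p) x by rewrite rp.
rewrite pq rmorphM /= map_polyX rootM rp => /orP [|/rootP]; last first.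
  by rewrite hornerX => /eqP; rewrite (negPf x0).
by move=> /(dvdp_leq q0); rewrite pq size_mulX // ltnn.
Qed.

Lemma odd_descent n (A B : 'M[F]_n) : x != 0 -> anisotropic A -> anisotropic B ->
  qf_isometric (map_mx iota A) (x *: map_mx iota B) ->
  qf_isometric A (- p`_0 *: B).
Proof.
have [pm op rp sx] := xp; move=> x0 aA aB [P uP h].
have /fin_all_exists [S SP] : forall i, exists v : 'rV_n, row i P = evalv v.
  by move=> i; exact: evalv_surj.
(* The size is even and positive, hence of the form [2d+2]. *)
have sp : size p = ((size p).-2./2 + (size p).-2./2).+2.
  have := monic_neq0 pm; rewrite -size_poly_gt0; move: op; move: (size p) => k; lia.
apply: (descent_isometric (S := \matrix_i S i) aA aB pm sp) => [|v w vw].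
  exact: odd_generator_coef0.
have vwP : evalv v = evalv w *m P.
  have -> : P = map_mx (horner_eval x \o map_poly iota) (\matrix_i S i).
    by apply/row_matrixP => i; rewrite -map_row rowK SP.
  rewrite /evalv -map_mxM; apply/rowP => i; apply/eqP; rewrite -subr_eq0.
  have := vw i; rewrite -rp => /rootP; rewrite mxE [X in _ + X]mxE rmorphB /= hornerD hornerN.
  by rewrite !mxE => ->.
rewrite -rp; apply/rootP; rewrite rmorphB rmorphM /= map_polyX !hornerE.
by rewrite !qp_horner vwP h qf_scale subrr.
Qed.
End Odd.
End Extension.

(** * Reduction to anisotropic forms *)

(** Written as a matrix kernel, the radical commutes with scalar extension. *)
Lemma defectiveP (K : fieldType) n (A : 'M[K]_n) :
  defective A <-> exists v, [/\ v != 0, qf A v = 0 & v *m (A + A^T) = 0].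
Proof.
split=> -[v [v0 Av bv]]; exists v; split=> //; last first.
  by move=> y; rewrite /bf bv mul0mx mxE.
apply/rowP => j.
by rewrite [RHS]mxE -(bv (delta_mx 0 j)) /bf trmx_delta -colE [RHS]mxE.
Qed.

Lemma not_isotropic (K : fieldType) n (A : 'M[K]_n) : ~ isotropic A -> anisotropic A.
Proof. by move=> h v Av; apply/eqP; apply: contra_notT h => v0; exists v. Qed.

Section Reduction.
Variables (F E : fieldType) (iota : {rmorphism F -> E}).
Hypothesis anisotropic_ext : forall n (A : 'M[F]_n),
  anisotropic A -> anisotropic (map_mx iota A).
Implicit Types n : nat.

Lemma qf_map_mul m n (R : 'M[F]_(m, n)) (A : 'M_n) w :
  qf (map_mx iota (R *m A *m R^T)) w = qf (map_mx iota A) (w *m map_mx iota R).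
Proof. by rewrite qf_mul map_trmx -!map_mxM. Qed.

Lemma isotropic_descent n (A : 'M[F]_n) : isotropic (map_mx iota A) -> isotropic A.
Proof.
move=> [v v0 Av]; apply: NNPP => /not_isotropic /anisotropic_ext h.
by move: v0; rewrite (h v Av) eqxx.
Qed.

(** The radical is spanned over [F] by the rows of [R], and the form restricted to it is isotropic
    over [E], hence over [F]. *)
Lemma defective_descent n (A : 'M[F]_n) : defective (map_mx iota A) -> defective A.
Proof.
move=> /defectiveP [v [v0 Av]]; rewrite map_trmx -map_mxD => vC.
pose R := row_base (kermx (A + A^T)).
have RC : R *m (A + A^T) = 0 by apply/sub_kermxP; rewrite eq_row_base.
have /submxP [w vw] : (v <= map_mx iota R)%MS.
  apply: submx_trans (_ : (map_mx iota (kermx (A + A^T)) <= _)%MS).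
    by rewrite map_kermx; apply/sub_kermxP.
  by rewrite map_submx eq_row_base.
have [z z0 Az] : isotropic (R *m A *m R^T).
  apply: isotropic_descent; exists w.
    by apply: contraNneq v0 => w0; rewrite vw w0 mul0mx.
  by rewrite qf_map_mul -vw.
apply/defectiveP; exists (z *m R); split; last by rewrite -mulmxA RC mulmx0.
  apply: contraNneq z0 => zR; apply/eqP; apply: (row_free_inj (row_base_free (kermx (A + A^T)))).
  by rewrite mul0mx.
by rewrite qf_mul.
Qed.

Lemma defective_map n (A : 'M[F]_n) : defective A -> defective (map_mx iota A).
Proof.
move=> /defectiveP [v [v0 Av vC]]; apply/defectiveP; exists (map_mx iota v).
by rewrite map_mx_eq0 qf_map Av rmorph0 map_trmx -map_mxD -map_mxM vC raddf0.
Qed.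

Variables (lam : E) (a : F).
Hypotheses (lam0 : lam != 0) (a0 : a != 0).
Hypothesis anisotropic_case : forall n (A B : 'M[F]_n),
  anisotropic A -> anisotropic B ->
  qf_isometric (map_mx iota A) (lam *: map_mx iota B) -> qf_isometric A (a *: B).

Lemma isotropic_similar n (A B : 'M[F]_n) :
  qf_isometric (map_mx iota A) (lam *: map_mx iota B) -> isotropic A <-> isotropic B.
Proof.
move=> AB; split=> [/(isotropic_map iota)|] i.
  apply: isotropic_descent; apply/(isotropic_scale _ lam0).
  exact: isotropic_isometric AB i.
apply: isotropic_descent; apply: isotropic_isometric (qf_isometric_sym AB) _.
by apply/(isotropic_scale _ lam0); apply: isotropic_map.
Qed.

Lemma defective_similar n (A B : 'M[F]_n) :
  qf_isometric (map_mx iota A) (lam *: map_mx iota B) -> defective A <-> defective B.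
Proof.
move=> AB; split=> [/defective_map|] i.
  apply: defective_descent; apply/(defective_scale _ lam0).
  exact: defective_isometric AB i.
apply: defective_descent; apply: defective_isometric (qf_isometric_sym AB) _.
by apply/(defective_scale _ lam0); apply: defective_map.
Qed.

(** Since [H] absorbs the factor [c], both sides acquire the same summand, ready to be cancelled. *)
Lemma osum_similar (K L : fieldType) (f : {rmorphism K -> L}) (c : L) m n
    (H : 'M[K]_m) (A B : 'M[K]_(m + n)) A' B' :
  qf_isometric (c *: map_mx f H) (map_mx f H) ->
  qf_isometric A (osum H A') -> qf_isometric B (osum H B') ->
  qf_isometric (map_mx f A) (c *: map_mx f B) ->
  qf_isometric (osum (map_mx f H) (map_mx f A'))
    (osum (map_mx f H) (c *: map_mx f B')).
Proof.
move=> cH /(qf_isometric_map f) AA /(qf_isometric_map f) BB AB.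
rewrite -osum_map; apply: qf_isometric_trans (qf_isometric_sym AA) _.
apply: qf_isometric_trans AB _.
apply: qf_isometric_trans (qf_isometric_scale c BB) _.
rewrite osum_map scale_osum; apply: qf_isometric_osum cH _.
exact: qf_isometric_refl.
Qed.

Lemma osum_glue (K : fieldType) (c : K) m n (H : 'M[K]_m) (A B : 'M[K]_(m + n)) A' B' :
  qf_isometric H (c *: H) ->
  qf_isometric A (osum H A') -> qf_isometric B (osum H B') ->
  qf_isometric A' (c *: B') -> qf_isometric A (c *: B).
Proof.
move=> cH AA BB AB; apply: qf_isometric_trans AA _.
apply: qf_isometric_trans (qf_isometric_osum cH AB) _.
by rewrite -scale_osum; apply/qf_isometric_scale/qf_isometric_sym.
Qed.

(** Induction on the dimension. Zero summands are split off first, because hyperbolic planes are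
    obtained from isotropic forms that are not defective. *)
Lemma similar_descent n (A B : 'M[F]_n) :
  qf_isometric (map_mx iota A) (lam *: map_mx iota B) -> qf_isometric A (a *: B).
Proof.
have [k] := ubnP n; elim: k n A B => // k IH n A B /ltnSE nk AB.
have [dA|dA] := classic (defective A).
  have dB := (defective_similar AB).1 dA.
  case: n A B nk AB dA dB => [|n] A B nk AB dA dB.
    by case: dA => v [/negP[]]; rewrite thinmx0.
  have [A' AA'] := split_defective dA; have [B' BB'] := split_defective dB.
  apply: (osum_glue _ AA' BB').
    by rewrite scaler0; apply: qf_isometric_refl.
  apply: (IH) => //; apply: cancel_defective.
  have := osum_similar _ AA' BB' AB; rewrite raddf0 scaler0; apply.
  exact: qf_isometric_refl.
have dB : ~ defective B by move/(defective_similar AB).2.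
have [iA|iA] := classic (isotropic A); last first.
  apply: (anisotropic_case _ _ AB); apply: not_isotropic => //.
  by move/(isotropic_similar AB).2.
have iB := (isotropic_similar AB).1 iA.
have [v [u [Av Au vu]]] := hyperbolic_pair iA dA.
(* The pair forces dimension at least two, so the dimension can be written [1 + 1 + n]. *)
have := pair_dim Av Au vu; clear v u Av Au vu.
case: n A B nk AB dA dB iA iB => [|[|n]] A B nk AB dA dB iA iB // _.
have [A' AA'] := split_hyperbolic (iA : isotropic (A : 'M_(1 + 1 + n))) dA.
have [B' BB'] := split_hyperbolic (iB : isotropic (B : 'M_(1 + 1 + n))) dB.
apply: (osum_glue _ AA' BB'); first exact/qf_isometric_sym/hyp_scale.
apply: (IH); first by apply: leq_trans nk; apply: ltnW.
apply: cancel_hyperbolic; rewrite -(hyp_map iota); apply: (osum_similar _ AA' BB' AB).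
by rewrite hyp_map; apply: hyp_scale.
Qed.

End Reduction.

(** * Field extensions of odd degree in characteristic 2 *)

(* [minPoly] only exists inside [L]; the embedding [j] allows [E] to be a proper
   subfield of [L], whose base field [F] has image [K] under [j \o iota]. *)
Lemma minPoly_odd_generator (F0 : fieldType) (L : fieldExtType F0)
    (K : {subfield L}) (F E : fieldType) (iota : {rmorphism F -> E})
    (j : {rmorphism E -> L}) (x : E) :
  (forall q, reflect (exists q', q = map_poly j (map_poly iota q')) (q \is a polyOver K)) ->
  (forall y, j y \in <<K; j x>>%VS) ->
  odd (adjoin_degree K (j x)) ->
  exists2 p, map_poly j (map_poly iota p) = minPoly K (j x) & odd_generator iota x p.
Proof.
move=> KP Kx ox; have /KP [p pE] := minPolyOver K (j x).
have sp : size p = (adjoin_degree K (j x)).+1.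
  by rewrite -(size_minPoly K (j x)) pE !size_map_poly.
exists p => //; split.
- by have := monic_minPoly K (j x); rewrite pE !map_monic.
- by rewrite sp oddS negbK.
- move=> q; rewrite -(fmorph_root j) -(dvdp_map iota) -(dvdp_map j) -pE.
  apply/idP/idP => [|qx]; last first.
    by rewrite -dvdp_XsubCl (dvdp_trans _ qx) // dvdp_XsubCl root_minPoly.
  by apply: minPoly_dvdp; apply/KP; exists q.
- move=> y; have /Fadjoin_polyP [r /KP [q ->]] := Kx y.
  by rewrite horner_map => /fmorph_inj ->; exists q.
Qed.

(** * Separability and square generators *)

Section OddExtension.
Variables (F : fieldType) (L : fieldExtType F).
Hypotheses (ch2 : 2 \in [pchar F]) (oL : odd (\dim (fullv : {vspace L}))).
Implicit Types (K : {subfield L}) (x : L).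

Lemma pchar2L : 2 \in [pchar L].
Proof. by rewrite pchar_lalg. Qed.

Lemma odd_adjoin_degree K x : odd (adjoin_degree K x).
Proof.
have := field_dimS (subvf <<K; x>>%AS); rewrite dim_Fadjoin => /dvdn_odd /(_ oL).
by rewrite oddM => /andP [].
Qed.

(** The derivative of a monic polynomial of odd degree keeps its top coefficient, the degree, which
    is 1 in characteristic 2. *)
Lemma separable_odd K x : separable_element K x.
Proof.
rewrite separable_nz_der; apply/negP => /eqP.
have [k kE] : exists k, adjoin_degree K x = k.+1 by eexists.
have o := odd_adjoin_degree K x; have := monic_minPoly K x.
rewrite monicE lead_coefE size_minPoly succnK => /eqP lc /(congr1 (coefp k)).
rewrite /= coef_deriv coef0 -kE lc => /eqP.
by rewrite -(dvdn_pcharf pchar2L) dvdn2 o.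
Qed.

(** A primitive element [t] is separable, which in characteristic 2 means that [t] lies in [K(t^2)].
    If [t = 0], then [L = K] and 1 serves. *)
Lemma square_generator K :
  exists t, [/\ t != 0, <<K; t>>%VS = fullv & <<K; t ^+ 2>>%VS = fullv].
Proof.
have sK : separable K fullv by apply/separableP => x _; apply: separable_odd.
have e := eq_adjoin_separable_generator sK (subvf _).
set t := separable_generator K fullv in e.
have [t0|t0] := eqVneq t 0.
  exists 1; rewrite oner_neq0 expr1n.
  have /Fadjoin_idP -> : 1 \in K by rewrite rpred1.
  by rewrite e t0; split=> //; apply/esym/Fadjoin_idP; rewrite rpred0.
exists t; split=> //; apply/eqP; rewrite eqEsubv subvf /= e.
apply/FadjoinP; split; first exact: subv_adjoin.
by rewrite -(pcharf_p_separable K t 0 pchar2L); apply: separable_odd.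
Qed.

(** Applying Frobenius to the coefficients of the minimal polynomial of [t] gives a monic polynomial
    vanishing at [t^2]; its degree is right because both elements generate [L]. *)
Lemma minPoly_square_coef0 K t :
  <<K; t>>%VS = fullv -> <<K; t ^+ 2>>%VS = fullv ->
  (minPoly K (t ^+ 2))`_0 = (minPoly K t)`_0 ^+ 2.
Proof.
move=> Kt Kt2; pose f := pFrobenius_aut pchar2L.
pose q := map_poly f (minPoly K t).
have qK : q \is a polyOver K.
  apply/polyOverP => i; rewrite coef_map /= /f pFrobenius_autE rpredX //.
  exact/polyOverP/minPolyOver.
have qt : root q (t ^+ 2).
  by rewrite -(pFrobenius_autE pchar2L) /q fmorph_root root_minPoly.
have mq : q \is monic by rewrite map_monic monic_minPoly.
have /eqP : minPoly K (t ^+ 2) == q.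
  rewrite -eqp_monic ?monic_minPoly // -dvdp_size_eqp ?minPoly_dvdp //.
  by rewrite size_map_poly !size_minPoly !adjoin_degreeE Kt Kt2.
by move=> ->; rewrite coef_map /= /f pFrobenius_autE.
Qed.

End OddExtension.

(** * Descent from [L] to [F(lam)] and from there to [F] *)

Section Main.
Variables (F : fieldType) (L : fieldExtType F).
Hypotheses (ch2 : 2 \in [pchar F]) (oL : odd (\dim (fullv : {vspace L}))).

Lemma qf_ext_anisotropic n (A : 'M[F]_n) : anisotropic A -> anisotropic (qf_ext L A).
Proof.
have [t [_ Kt _]] := square_generator ch2 oL 1%AS.
have [|||p _ gp] := @minPoly_odd_generator F L 1%AS F L (in_alg L) idfun t.
- move=> q; apply: (iffP polyOver1P) => -[q' ->]; exists q'.
    by rewrite map_poly_id.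
  by rewrite map_poly_id.
- by move=> y; rewrite Kt memvf.
- exact: odd_adjoin_degree.
exact: springer gp n A.
Qed.

Section Simple.
Variable lam : L.
Hypothesis lam0 : lam != 0.
Let K := <<1; lam>>%AS.
Let lamK : subvs_of K := Subvs (memv_adjoin 1 lam).

Lemma map_vsval_in_alg n (A : 'M[F]_n) :
  map_mx vsval (map_mx (in_alg (subvs_of K)) A) = qf_ext L A.
Proof. by apply/matrixP => i j; rewrite !mxE rmorph_alg. Qed.

Lemma anisotropic_subfield n (A : 'M[F]_n) :
  anisotropic A -> anisotropic (map_mx (in_alg (subvs_of K)) A).
Proof.
move=> /qf_ext_anisotropic aA v Av; apply/eqP.
rewrite -(map_mx_eq0 (vsval : {rmorphism subvs_of K -> L})).
by apply/eqP/aA; rewrite -map_vsval_in_alg qf_map Av rmorph0.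
Qed.

(** Over [L] the form [B] is isometric to [t^2 B], so descent with generator [t^2] applies. The
    factor it produces is the square [b ^+ 2], the sign being trivial in characteristic 2, and is
    absorbed. *)
Lemma descent_to_subfield n (A B : 'M[subvs_of K]_n) :
  anisotropic A -> anisotropic B ->
  qf_isometric (map_mx vsval A) (map_mx vsval B) -> qf_isometric A B.
Proof.
move=> aA aB AB; have [t [t0 Kt Kt2]] := square_generator ch2 oL K.
have [|||p pE gp] := @minPoly_odd_generator F L K (subvs_of K) L vsval idfun (t ^+ 2).
- move=> q; apply: (iffP polyOver_subvs) => -[q' ->]; exists q'.
    by rewrite map_poly_id.
  by rewrite map_poly_id.
- by move=> y; rewrite Kt2 memvf.
- exact: odd_adjoin_degree.
have p0 := odd_generator_coef0 gp (expf_neq0 2 t0).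
have /polyOverP/(_ 0) Kb := minPolyOver K t; pose b : subvs_of K := Subvs Kb.
have pb : p`_0 = b ^+ 2.
  apply: val_inj; rewrite rmorphXn /= -(minPoly_square_coef0 ch2 Kt Kt2) -pE.
  by rewrite map_poly_id // coef_map.
have b0 : b != 0 by move: p0; rewrite pb expf_eq0.
have := odd_descent gp (expf_neq0 2 t0) aA aB _.
rewrite pb => h; apply: qf_isometric_trans (h _) _.
  exact: qf_isometric_trans AB (qf_isometric_square _ t0).
rewrite oppr_pchar2 ?pchar_lalg //.
exact/qf_isometric_sym/qf_isometric_square.
Qed.

Lemma generator_subfield : exists2 p,
  map_poly (in_alg L) p = minPoly 1%AS lam & odd_generator (in_alg (subvs_of K)) lamK p.
Proof.
have [|||p pE gp] := @minPoly_odd_generator F L 1%AS F (subvs_of K) (in_alg _) vsval lamK.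
- move=> q; apply: (iffP polyOver1P) => -[q' ->]; exists q'.
    by rewrite -map_poly_comp; apply: eq_map_poly => c; rewrite [RHS]rmorph_alg.
  by rewrite -map_poly_comp; apply: eq_map_poly => c; rewrite [LHS]rmorph_alg.
- by move=> y; apply: subvsP.
- exact: odd_adjoin_degree.
exists p => //; rewrite -pE -map_poly_comp.
by apply: eq_map_poly => c; rewrite [RHS]rmorph_alg.
Qed.

Lemma anisotropic_descent n (A B : 'M[F]_n) an :
  an%:A = (minPoly 1%AS lam)`_0 -> anisotropic A -> anisotropic B ->
  qf_isometric (qf_ext L A) (lam *: qf_ext L B) -> qf_isometric A (an *: B).
Proof.
move=> anE aA aB; rewrite -!map_vsval_in_alg.
have -> : lam = vsval lamK by [].
rewrite -map_mxZ => AB.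
have lamK0 : lamK != 0 by [].
have aK := anisotropic_subfield aA; have bK := anisotropic_subfield aB.
(* The scalar [lam] lies in the subfield, so the isometry onto [lam B] descends there; anisotropy of
   [lam B] is left for the end. *)
have {}AB := descent_to_subfield aK _ AB.
have [p pE gp] := generator_subfield.
have -> : an = - p`_0.
  rewrite oppr_pchar2 //; apply: (fmorph_inj (in_alg L)).
  by rewrite /= anE -pE coef_map.
apply: (odd_descent gp lamK0 aA aB); apply: AB => v.
rewrite qf_scale => /eqP; rewrite mulf_eq0 (negPf lamK0) => /eqP.
exact: bK.
Qed.

Lemma minPoly_coef0 (an : F) : an%:A = (minPoly 1%AS lam)`_0 -> an != 0.
Proof.
have [p pE gp] := generator_subfield; rewrite -pE coef_map => e.
have -> : an = p`_0 by apply: (fmorph_inj (in_alg L)).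
exact: odd_generator_coef0 gp lam0.
Qed.
End Simple.
End Main.

Theorem theorem6p5 (F : fieldType) (L : fieldExtType F) (n : nat)
    (A B : 'M[F]_n) :
  2 \in [pchar F] ->
  odd (\dim (fullv : {vspace L})) ->
  (qf_similar A B <-> qf_similar (qf_ext L A) (qf_ext L B)) /\
  (forall lam : L, lam != 0 ->
     qf_isometric (qf_ext L A) (lam *: qf_ext L B) ->
     forall an : F, an%:A = (minPoly 1%AS lam)`_0 ->
     qf_isometric A (an *: B)).
Proof.
move=> ch2 oL.
have descent (lam : L) : lam != 0 ->
    qf_isometric (qf_ext L A) (lam *: qf_ext L B) ->
    forall an : F, an%:A = (minPoly 1%AS lam)`_0 -> qf_isometric A (an *: B).
  move=> lam0 AB an anE; have an0 := minPoly_coef0 oL lam0 anE.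
  apply: (similar_descent (iota := in_alg L) _ lam0 an0 _ AB) => m C D.
    exact: qf_ext_anisotropic.
  exact: anisotropic_descent anE.
split=> //; split=> [[c c0 AB]|[lam lam0 AB]].
  exists c%:A; first by rewrite scaler_eq0 oner_eq0 orbF.
  have := qf_isometric_map (in_alg L) AB; rewrite map_mxZ; exact.
(* The constant term of the minimal polynomial lies in the line of 1, that is, in [F]; it is the
   similarity factor. *)
have /polyOverP/(_ 0)/vlineP [an anE] := minPolyOver 1%AS lam.
exists an; first exact: (minPoly_coef0 oL lam0 (esym anE)).
exact: descent lam0 AB an (esym anE).
Qed.
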